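(* Let $X$ be an arbitrary locally finite preordered set with connected components $X_i$, $i\in I$, let $R$ be a $T$-algebra and $K=I(X,R)$. Then (as $T$-modules): 1(a). $\Omega=D_L+\mathrm{In}(\mathrm{Der}\,L)$ and $\Omega/\mathrm{In}(\mathrm{Der}\,L)\cong\prod_{|I|}\mathrm{Out}\,R$ (the product of $|I|$ copies of $\mathrm{Out}\,R$). 1(b). $\Lambda=\mathrm{In}_0(\mathrm{Der}\,K)+(\Psi\oplus D_K)$ and $$\mathrm{Der}\,K=\mathrm{In}(\mathrm{Der}\,K)+(\Psi\oplus D_K)=\mathrm{In}_1(\mathrm{Der}\,K)\oplus\big(\mathrm{In}_0(\mathrm{Der}\,K)+(\Psi\oplus D_K)\big).$$ 2. $\mathrm{Out}\,K\cong\Psi/\Psi_0\oplus\prod_{|I|}\mathrm{Out}\,R$.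
   Context: Rings are associative with nonzero identity; $T$ is a commutative ring. $(X,\le)$ is a preordered set (reflexive, transitive) all of whose intervals $\{z:x\le z\le y\}$ are finite; $x\sim y$ iff $x\le y$ and $y\le x$. Connected components are the classes of the relation ''joined by a finite sequence in which consecutive elements are comparable''. $K=I(X,R)$ is the $T$-algebra of functions $f:X\times X\to R$ with $f(x,y)=0$ if $x\not\le y$, pointwise addition and $T$-action, product $(fg)(x,y)=\sum_{x\le z\le y}f(x,z)g(z,y)$. $L=\{f: f(x,y)=0\text{ if }x\not\sim y\}$ (subalgebra), $M=\{f: f(x,y)=0\text{ if }x\sim y\}$ (ideal), $K=L\oplus M$. Moreover $K=\prod_{i\in I}K_i$ with $K_i=I(X_i,R)$. For a $T$-algebra $A$: $\mathrm{Der}\,A$ is the $T$-module of derivations ($T$-linear $d$ with $d(ab)=d(a)b+ad(b)$), $d_c(a)=ac-ca$ is the inner derivation defined by $c$, $\mathrm{In}(\mathrm{Der}\,A)$ the submodule of inner derivations, $\mathrm{Out}\,A=\mathrm{Der}\,A/\mathrm{In}(\mathrm{Der}\,A)$. $\mathrm{In}_0(\mathrm{Der}\,K)$ (resp. $\mathrm{In}_1(\mathrm{Der}\,K)$): inner derivations of $K$ defined by elements of $L$ (resp. $M$). Every derivation $d$ of $K$ satisfies $d(M)\subseteq M$, so $d(a+b)=\alpha(a)+(\delta(a)+\beta(b))$ for $a\in L,b\in M$, with $\alpha:L\to L$, $\delta:L\to M$, $\beta:M\to M$ $T$-linear and $\alpha\in\mathrm{Der}\,L$. $\Omega\subseteq\mathrm{Der}\,L$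 is the image of the homomorphism $d\mapsto\alpha$. $\Lambda$: derivations with $\delta=0$. $\Psi$: derivations with $\alpha=0,\delta=0$. $\Psi_0$: inner derivations of $K$ defined by central elements of the ring $L$. Ring derivations: each family $(\varepsilon_i)_{i\in I}$ with $\varepsilon_i\in\mathrm{Der}\,R$ gives a derivation $\overline\varepsilon$ of $K$ with $\overline\varepsilon(g)(x,y)=\varepsilon_i(g(x,y))$ for $x,y\in X_i$ (and $g(x,y)=0$ when $x,y$ lie in different components); it restricts to a derivation of $L$. $D_K\subseteq\mathrm{Der}\,K$ and $D_L\subseteq\mathrm{Der}\,L$ are the submodules of all derivations of $K$, resp. $L$, obtained in this way. *)

(* Defs.v *)
From HB Require Import structures.
From mathcomp Require Import all_boot all_order all_algebra.
From mathcomp Require Import finmap.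
From mathcomp Require Import all_classical.

Set Implicit Arguments.
Unset Strict Implicit.
Unset Printing Implicit Defensive.

Import Order.TTheory GRing.Theory.
Local Open Scope classical_set_scope.
Local Open Scope ring_scope.
Local Open Scope quotient_scope.

Section Submodules.
Variables (T : pzRingType) (V : lmodType T).

Definition add_pred (A B : {pred V}) : {pred V} :=
  fun v => `[< exists a b, [/\ a \in A, b \in B & v = a + b] >].

Definition independent (A B : {pred V}) : Prop :=
  forall v, v \in A -> v \in B -> v = 0.

Record subm (S : submodClosed V) := Subm { subm_val :> V; _ : subm_val \in S }.

HB.instance Definition _ (S : submodClosed V) := [isSub for @subm_val S].
HB.instance Definition _ (S : submodClosed V) := [Choice of subm S by <:].
HB.instance Definition _ (S : submodClosed V) :=
  [SubChoice_isSubLmodule of subm S by <:].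

End Submodules.

Infix ":+:" := add_pred (at level 50, left associativity) : ring_scope.

Section ModuleQuotient.
Variables (T : pzRingType) (V : lmodType T) (W : submodClosed V).

Fact lquot_oppr_closed : oppr_closed W.
Proof. by move=> v Wv; rewrite -scaleN1r rpredZ. Qed.

Definition zmod_of_submod : zmodClosed V :=
  HB.pack_for (zmodClosed V) (GRing.SubmodClosed.sort W)
    (GRing.isOppClosed.Build V (GRing.SubmodClosed.sort W) lquot_oppr_closed).

Definition lquot := Quotient.quot zmod_of_submod.
HB.instance Definition _ := EqQuotient.on lquot.
HB.instance Definition _ := GRing.Zmodule.on lquot.

Definition lquot_scale (t : T) (u : lquot) : lquot :=
  \pi_lquot (t *: repr u).

Lemma lquot_eq (u v : V) : (\pi_lquot u = \pi_lquot v) <-> (u - v \in W).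
Proof.
have E : (u - v \in W) = (\pi_lquot u == \pi_lquot v).
  exact: (Quotient.idealrBE zmod_of_submod).
by rewrite E; split=> /eqP.
Qed.

Lemma lquot_pi_add (u v : V) :
  \pi_lquot (u + v) = \pi_lquot u + \pi_lquot v.
Proof. exact: (Quotient.pi_add zmod_of_submod). Qed.

Lemma lquot_pi_scale (t : T) (u : V) :
  lquot_scale t (\pi_lquot u) = \pi_lquot (t *: u).
Proof.
rewrite /lquot_scale; apply/lquot_eq; rewrite -scalerBr; apply: (@rpredZ _ _ W).
by apply/lquot_eq; rewrite reprK.
Qed.

Fact lquot_scaleA a b u :
  lquot_scale a (lquot_scale b u) = lquot_scale (a * b) u.
Proof.
rewrite -[u]reprK [lquot_scale b _]lquot_pi_scale.
by rewrite !lquot_pi_scale scalerA.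
Qed.

Fact lquot_scale1 : left_id 1 lquot_scale.
Proof. by move=> u; rewrite -[u]reprK lquot_pi_scale scale1r. Qed.

Fact lquot_scaleDr : right_distributive lquot_scale +%R.
Proof.
move=> a u v; rewrite -[u]reprK -[v]reprK -lquot_pi_add !lquot_pi_scale.
by rewrite scalerDr lquot_pi_add.
Qed.

Fact lquot_scaleDl u : {morph lquot_scale^~ u : a b / a + b}.
Proof.
by move=> a b; rewrite -[u]reprK !lquot_pi_scale scalerDl lquot_pi_add.
Qed.

HB.instance Definition _ := GRing.Zmodule_isLmodule.Build T lquot
  lquot_scaleA lquot_scale1 lquot_scaleDr lquot_scaleDl.

End ModuleQuotient.

Section SubmoduleQuotient.
Variables (T : pzRingType) (V : lmodType T) (A B : submodClosed V).

Definition in_subm : {pred subm A} := fun a => val a \in B.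

Fact in_subm_closed : submod_closed in_subm.
Proof.
split=> [|t a b]; first exact: (@rpred0 _ B).
rewrite /in_subm /in_mem /= => Ba Bb.
by apply: (@rpredD _ B) => //; apply: (@rpredZ _ _ B).
Qed.

HB.instance Definition _ := GRing.isSubmodClosed.Build T (subm A) in_subm
  in_subm_closed.

(* The quotient A / B, to be used when B is contained in A. *)
Definition subquot := lquot in_subm.
HB.instance Definition _ := GRing.Lmodule.on subquot.

End SubmoduleQuotient.

Definition lmod_iso (T : pzRingType) (U V : lmodType T) : Prop :=
  exists f : {linear U -> V}, bijective f.

Section Derivations.
Variables (T : comNzRingType) (A : algType T).

Definition der_pred : {pred A -> A} := fun d =>
  `[< (forall t a b, d (t *: a + b) = t *: d a + d b) /\
      (forall a b, d (a * b) = d a * b + a * d b) >].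

Fact der_pred_closed : submod_closed der_pred.
Proof.
split=> [|s d e /asboolP[dL dM] /asboolP[eL eM]]; apply/asboolP; split.
- by move=> t a b; rewrite /= scaler0 addr0.
- by move=> a b; rewrite /= mul0r mulr0 addr0.
- move=> t a b; rewrite -[LHS]/(s *: d (t *: a + b) + e (t *: a + b)) dL eL.
  rewrite -[RHS]/(t *: (s *: d a + e a) + (s *: d b + e b)).
  by rewrite !scalerDr !scalerA [s * t]mulrC addrACA.
move=> a b; rewrite -[LHS]/(s *: d (a * b) + e (a * b)) dM eM.
rewrite -[RHS]/((s *: d a + e a) * b + a * (s *: d b + e b)).
by rewrite scalerDr mulrDl mulrDr scalerAl scalerAr addrACA.
Qed.

HB.instance Definition _ := GRing.isSubmodClosed.Build T (A -> A) der_pred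
  der_pred_closed.

Record Der := MkDer { der_fun :> A -> A; _ : der_fun \in der_pred }.

HB.instance Definition _ := [isSub for der_fun].
HB.instance Definition _ := [Choice of Der by <:].
HB.instance Definition _ := [SubChoice_isSubLmodule of Der by <:].

Fact inner_subproof (c : A) : (fun a => a * c - c * a) \in der_pred.
Proof.
apply/asboolP; split=> [t a b|a b].
  by rewrite mulrDl mulrDr -scalerAl -scalerAr scalerBr opprD addrACA.
by rewrite mulrBl mulrBr !mulrA [RHS]addrC addrA subrK.
Qed.

Definition inner (c : A) : Der := MkDer (inner_subproof c).

Definition inner_by (S : {pred A}) : {pred Der} :=
  fun d => `[< exists2 c, c \in S & d = inner c >].

Lemma inner_linear t c c' : inner (t *: c + c') = t *: inner c + inner c'.
Proof.
apply/val_inj/funext => a /=; rewrite -[RHS]/(t *: inner c a + inner c' a) /=.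
by rewrite mulrDl mulrDr -scalerAl -scalerAr scalerBr opprD addrACA.
Qed.

Lemma inner_by_closed (S : {pred A}) :
  submod_closed S -> submod_closed (inner_by S).
Proof.
move=> [S0 Slin]; split.
  apply/asboolP; exists 0 => //; apply/val_inj/funext => a /=.
  by rewrite mulr0 mul0r subrr.
move=> t d e /asboolP[c Sc ->] /asboolP[c' Sc' ->]; apply/asboolP.
by exists (t *: c + c'); rewrite ?inner_linear //; apply: Slin.
Qed.

Definition InDer : {pred Der} := inner_by predT.

HB.instance Definition _ := GRing.isSubmodClosed.Build T Der InDer
  (inner_by_closed (conj isT (fun _ _ _ _ _ => isT))).

Definition Out := lquot InDer.
HB.instance Definition _ := GRing.Lmodule.on Out.

End Derivations.

Arguments InDer {T} A.

(* Nonemptiness reflects the convention that rings have a nonzero identity:  *)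
(* the incidence ring of the empty preordered set is the zero ring.          *)
HB.mixin Record isLocallyFinite d X of Order.Preorder d X := {
  interval_finite : forall x y : X, finite_set [set z | (x <= z <= y)%O];
  carrier_inhabited : inhabited X
}.

#[short(type="locFinPreorderType")]
HB.structure Definition LocFinPreorder d :=
  {X of Order.Preorder d X & isLocallyFinite d X}.

Section Preorder.
Variables (d : Order.disp_t) (X : locFinPreorderType d).

Definition ord_equiv (x y : X) : bool := (x <= y)%O && (y <= x)%O.

Definition connected_by (x y : X) : Prop :=
  exists p : seq X, path (fun a b => (a >=< b)%O) x p /\ last x p = y.

Definition component : set (set X) :=
  [set C | exists x, C = [set y | connected_by x y]].

Definition interval (x y : X) : set X := [set z | (x <= z <= y)%O].

End Preorder.

Arguments component {d} X.

Section IncidenceAlgebra.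
Variables (d : Order.disp_t) (X : locFinPreorderType d).
Variables (T : comNzRingType) (R : algType T).

Definition incidence_pred : {pred X -> X -> R} :=
  fun f => `[< forall x y, ~~ (x <= y)%O -> f x y = 0 >].

Fact incidence_pred_closed : submod_closed incidence_pred.
Proof.
split=> [|t f g /asboolP Hf /asboolP Hg]; apply/asboolP => x y xy //=.
by rewrite -[LHS]/(t *: f x y + g x y) Hf // Hg // scaler0 addr0.
Qed.

HB.instance Definition _ := GRing.isSubmodClosed.Build T (X -> X -> R)
  incidence_pred incidence_pred_closed.

Record incidence := Incidence {
  incidence_fun :> X -> X -> R;
  _ : incidence_fun \in incidence_pred
}.

HB.instance Definition _ := [isSub for incidence_fun].
HB.instance Definition _ := [Choice of incidence by <:].
HB.instance Definition _ := [SubChoice_isSubLmodule of incidence by <:].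

Implicit Types f g h : incidence.

Lemma incidence0 f x y : ~~ (x <= y)%O -> f x y = 0.
Proof. by case: f => f /= /asboolP; apply. Qed.

Lemma incidence_ext f g :
  (forall x y, (x <= y)%O -> f x y = g x y) -> f = g.
Proof.
move=> fg; apply/val_inj/funext => x; apply/funext => y /=.
have [xy|xy] := boolP (x <= y)%O; first exact: fg.
by rewrite !incidence0.
Qed.

Fact incidence_mul_subproof f g :
  (fun x y => \sum_(z \in interval x y) (f x z * g z y)) \in incidence_pred.
Proof.
apply/asboolP => x y /negP xy; rewrite fsbig1 // => z /= /andP[xz zy].
by case: xy; apply: le_trans zy.
Qed.

Definition incidence_mul f g : incidence :=
  Incidence (incidence_mul_subproof f g).

Fact incidence_one_subproof :
  (fun x y => (x == y)%:R : R) \in incidence_pred.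
Proof. by apply/asboolP => x y; case: eqP => // ->; rewrite lexx. Qed.

Definition incidence_one : incidence := Incidence incidence_one_subproof.

Lemma incidence_mul_widen f g (x y a b : X) : (a <= x)%O -> (y <= b)%O ->
  incidence_mul f g x y =
  \sum_(z <- fset_set (interval a b)) (f x z * g z y).
Proof.
move=> ax yb /=; rewrite -fsbig_finite; last exact: interval_finite.
apply: fsbig_widen => [z /= /andP[xz zy]|z /= [_ xzy]].
  by rewrite /interval /= (le_trans ax xz) (le_trans zy yb).
rewrite /preimage /=; have [xz|/incidence0 ->] := boolP (x <= z)%O;
  last by rewrite mul0r.
have [zy|/incidence0 ->] := boolP (z <= y)%O; last by rewrite mulr0.
by case: xzy; rewrite /interval /= xz zy.
Qed.

Lemma incidence_mulE f g (x y : X) :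
  incidence_mul f g x y =
  \sum_(z <- fset_set (interval x y)) (f x z * g z y).
Proof. exact: incidence_mul_widen. Qed.

Lemma mem_interval (x y z : X) :
  (z \in fset_set (interval x y)) = (x <= z <= y)%O.
Proof.
rewrite in_fset_set; last exact: interval_finite.
by apply/idP/idP; rewrite inE.
Qed.

Fact incidence_mulA : associative incidence_mul.
Proof.
move=> f g h; apply: incidence_ext => x y xy; rewrite !incidence_mulE.
transitivity (\sum_(z <- fset_set (interval x y))
    \sum_(w <- fset_set (interval x y)) (f x z * (g z w * h w y))).
  rewrite big_seq [RHS]big_seq; apply: eq_bigr => z.
  rewrite mem_interval => /andP[xz zy].
  by rewrite (incidence_mul_widen _ _ xz (lexx y)) big_distrr.
rewrite exchange_big big_seq [RHS]big_seq; apply: eq_bigr => w.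
rewrite mem_interval => /andP[xw wy].
rewrite (incidence_mul_widen _ _ (lexx x) wy) big_distrl.
by apply: eq_bigr => z _; rewrite mulrA.
Qed.

Fact incidence_mul1f : left_id incidence_one incidence_mul.
Proof.
move=> f; apply: incidence_ext => x y xy; rewrite incidence_mulE.
rewrite (bigD1_seq x) ?fset_uniq ?mem_interval ?lexx //= eqxx mul1r.
by rewrite big1 ?addr0 // => z; rewrite eq_sym => /negPf ->; rewrite mul0r.
Qed.

Fact incidence_mulf1 : right_id incidence_one incidence_mul.
Proof.
move=> f; apply: incidence_ext => x y xy; rewrite incidence_mulE.
rewrite (bigD1_seq y) ?fset_uniq ?mem_interval ?lexx ?xy //= eqxx mulr1.
by rewrite big1 ?addr0 // => z /negPf ->; rewrite mulr0.
Qed.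

Fact incidence_mulDl : left_distributive incidence_mul +%R.
Proof.
move=> f g h; apply: incidence_ext => x y xy.
rewrite -[RHS]/(incidence_mul f h x y + incidence_mul g h x y).
rewrite !incidence_mulE -big_split; apply: eq_bigr => z _.
exact: mulrDl.
Qed.

Fact incidence_mulDr : right_distributive incidence_mul +%R.
Proof.
move=> f g h; apply: incidence_ext => x y xy.
rewrite -[RHS]/(incidence_mul f g x y + incidence_mul f h x y).
rewrite !incidence_mulE -big_split; apply: eq_bigr => z _.
exact: mulrDr.
Qed.

Fact incidence_one_neq0 : incidence_one != 0.
Proof.
apply/eqP => /(congr1 (fun f : incidence => f : X -> X -> R)) E.
have [x] := @carrier_inhabited d X.
by have /eqP := congr1 (fun f : X -> X -> R => f x x) E;
  rewrite /= eqxx oner_eq0.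
Qed.

HB.instance Definition _ := GRing.Zmodule_isNzRing.Build incidence
  incidence_mulA incidence_mul1f incidence_mulf1 incidence_mulDl incidence_mulDr
  incidence_one_neq0.

Fact incidence_scaleAl (t : T) f g : t *: (f * g) = (t *: f) * g.
Proof.
apply: incidence_ext => x y xy.
rewrite -[LHS]/(t *: incidence_mul f g x y).
rewrite -[RHS]/(incidence_mul (t *: f) g x y).
rewrite !incidence_mulE scaler_sumr; apply: eq_bigr => z _.
exact: scalerAl.
Qed.

HB.instance Definition _ := GRing.Lmodule_isLalgebra.Build T incidence
  incidence_scaleAl.

Fact incidence_scaleAr (t : T) f g : t *: (f * g) = f * (t *: g).
Proof.
apply: incidence_ext => x y xy.
rewrite -[LHS]/(t *: incidence_mul f g x y).
rewrite -[RHS]/(incidence_mul f (t *: g) x y).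
rewrite !incidence_mulE scaler_sumr; apply: eq_bigr => z _.
exact: scalerAr.
Qed.

HB.instance Definition _ := GRing.Lalgebra_isAlgebra.Build T incidence
  incidence_scaleAr.

Definition L_pred : {pred incidence} :=
  fun f => `[< forall x y, ~~ ord_equiv x y -> f x y = 0 >].

Definition M_pred : {pred incidence} :=
  fun f => `[< forall x y, ord_equiv x y -> f x y = 0 >].

Fact L_pred_closed : subalg_closed L_pred.
Proof.
split=> [|t f g /asboolP Hf /asboolP Hg|f g /asboolP Hf /asboolP Hg];
  apply/asboolP => x y xy.
- have /negPf E : x != y.
    by apply: contra xy => /eqP ->; rewrite /ord_equiv lexx.
  by rewrite -[LHS]/((x == y)%:R) E.
- by rewrite -[LHS]/(t *: f x y + g x y) Hf // Hg // scaler0 addr0.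
rewrite -[LHS]/(incidence_mul f g x y) incidence_mulE big1 // => z _.
have [/andP[xz zx]|nxz] := boolP (ord_equiv x z); last by rewrite Hf // mul0r.
rewrite Hg ?mulr0 //; apply: contra xy => /andP[zy yz].
by rewrite /ord_equiv (le_trans xz zy) (le_trans yz zx).
Qed.

Fact M_pred_closed : submod_closed M_pred.
Proof.
split=> [|t f g /asboolP Hf /asboolP Hg]; apply/asboolP => x y xy //.
by rewrite -[LHS]/(t *: f x y + g x y) Hf // Hg // scaler0 addr0.
Qed.

HB.instance Definition _ := GRing.isSubalgClosed.Build T incidence L_pred
  L_pred_closed.
HB.instance Definition _ := GRing.isSubmodClosed.Build T incidence M_pred
  M_pred_closed.

Record Lalg := MkL { L_val :> incidence; _ : L_val \in L_pred }.

HB.instance Definition _ := [isSub for L_val].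
HB.instance Definition _ := [Choice of Lalg by <:].
HB.instance Definition _ := [SubChoice_isSubAlgebra of Lalg by <:].

Definition restrict (P : X -> X -> bool) (f : incidence) (x y : X) : R :=
  if P x y then f x y else 0.

Fact restrict_subproof P f : restrict P f \in incidence_pred.
Proof.
by apply/asboolP => x y /incidence0 fxy; rewrite /restrict fxy if_same.
Qed.

Fact projL_subproof f :
  Incidence (restrict_subproof (@ord_equiv d X) f) \in L_pred.
Proof. by apply/asboolP => x y /negPf xy; rewrite /= /restrict xy. Qed.

Fact projM_subproof f :
  Incidence (restrict_subproof (fun x y => ~~ ord_equiv x y) f) \in M_pred.
Proof. by apply/asboolP => x y xy; rewrite /= /restrict xy. Qed.

Definition projL f : Lalg := MkL (projL_subproof f).
Definition projM f : subm M_pred := Subm (projM_subproof f).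

Lemma projLM f : f = val (projL f) + val (projM f).
Proof.
apply: incidence_ext => x y _.
rewrite -[RHS]/(projL f x y + val (projM f) x y) /= /restrict.
by case: ord_equiv; rewrite ?addr0 ?add0r.
Qed.

Lemma projL_linear t f g : projL (t *: f + g) = t *: projL f + projL g.
Proof.
apply/val_inj/incidence_ext => x y _.
rewrite -[RHS]/(t *: projL f x y + projL g x y) /= /restrict.
by case: ord_equiv; rewrite ?scaler0 ?addr0.
Qed.

Lemma projM_linear t f g : projM (t *: f + g) = t *: projM f + projM g.
Proof.
apply/val_inj/incidence_ext => x y _.
rewrite -[RHS]/(t *: val (projM f) x y + val (projM g) x y) /= /restrict.
by case: ord_equiv; rewrite ?scaler0 ?addr0.
Qed.

Lemma projL_mul f g : projL (f * g) = projL f * projL g.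
Proof.
apply/val_inj/incidence_ext => x y _.
rewrite -[LHS]/(if ord_equiv x y then incidence_mul f g x y else 0).
rewrite -[RHS]/(incidence_mul (projL f) (projL g) x y).
case: ifP => xy; last first.
  by have /asboolP -> // := valP (projL f * projL g); rewrite xy.
rewrite !incidence_mulE [LHS]big_seq [RHS]big_seq; apply: eq_bigr => z.
rewrite mem_interval => /andP[xz zy] /=; case/andP: xy => xy yx.
rewrite /restrict /ord_equiv xz zy (le_trans zy yx).
by rewrite (le_trans yx xz).
Qed.

Lemma L_valM (a b : Lalg) : val (a * b) = val a * val b.
Proof. exact: rmorphM. Qed.

Lemma projLK (a : Lalg) : projL (val a) = a.
Proof.
apply/val_inj/incidence_ext => x y _; rewrite /= /restrict.
by case: ifPn => // xy; case: a => a /= /asboolP ->.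
Qed.

(* For a derivation D of the incidence algebra and a in L, the L- and        *)
(* M-components of D a are alpha D a and delta D a.                          *)
Fact alpha_subproof (D : Der incidence) :
  (fun a : Lalg => projL (D (val a))) \in @der_pred T Lalg.
Proof.
case: D => D /= /asboolP[DL DM]; apply/asboolP; split=> [t a b|a b].
  have -> : val (t *: a + b) = t *: val a + val b by exact: linearP.
  by rewrite DL projL_linear.
rewrite L_valM DM -[X in X + _]scale1r projL_linear scale1r !projL_mul.
by rewrite !projLK.
Qed.

Definition alpha (D : Der incidence) : Der Lalg := MkDer (alpha_subproof D).

Definition delta (D : Der incidence) (a : Lalg) : subm M_pred :=
  projM (D (val a)).

Lemma alpha_linear t D E : alpha (t *: D + E) = t *: alpha D + alpha E.
Proof. by apply/val_inj/funext => a; exact: projL_linear. Qed.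

Lemma delta_linear t D E a :
  delta (t *: D + E) a = t *: delta D a + delta E a.
Proof. exact: projM_linear. Qed.

Definition Omega : {pred Der Lalg} := fun e => `[< exists D, alpha D = e >].

Fact Omega_closed : submod_closed Omega.
Proof.
have alpha0 : alpha 0 = 0.
  by have := alpha_linear (-1) 0 0; rewrite !scaleN1r !addNr.
split=> [|t _ _ /asboolP[D <-] /asboolP[E <-]]; apply/asboolP.
  by exists 0.
by exists (t *: D + E); rewrite alpha_linear.
Qed.

HB.instance Definition _ := GRing.isSubmodClosed.Build T (Der Lalg) Omega
  Omega_closed.

Definition Lambda : {pred Der incidence} :=
  fun D => `[< forall a, delta D a = 0 >].

Definition Psi : {pred Der incidence} :=
  fun D => `[< alpha D = 0 /\ forall a, delta D a = 0 >].

Fact Psi_closed : submod_closed Psi.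
Proof.
have alpha0 : alpha 0 = 0.
  by have := alpha_linear (-1) 0 0; rewrite !scaleN1r !addNr.
have delta0 a : delta 0 a = 0.
  by have := delta_linear (-1) 0 0 a; rewrite !scaleN1r !addNr.
split=> [|t D E /asboolP[D1 D2] /asboolP[E1 E2]]; apply/asboolP; split=> //.
  by rewrite alpha_linear D1 E1 scaler0 addr0.
by move=> a; rewrite delta_linear D2 E2 scaler0 addr0.
Qed.

HB.instance Definition _ := GRing.isSubmodClosed.Build T (Der incidence) Psi
  Psi_closed.

Definition In0 : {pred Der incidence} := inner_by L_pred.
Definition In1 : {pred Der incidence} := inner_by M_pred.

Definition centerL_pred : {pred incidence} :=
  fun c => `[< exists2 z : Lalg, (forall a, z * a = a * z) & c = val z >].

Fact centerL_pred_closed : submod_closed centerL_pred.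
Proof.
split=> [|t _ _ /asboolP[y yC ->] /asboolP[z zC ->]]; apply/asboolP.
  by exists 0 => // a; rewrite mul0r mulr0.
exists (t *: y + z); last by rewrite linearP.
by move=> a; rewrite mulrDl mulrDr -scalerAl -scalerAr yC zC.
Qed.

Definition Psi0 : {pred Der incidence} := inner_by centerL_pred.

HB.instance Definition _ := GRing.isSubmodClosed.Build T (Der incidence) Psi0
  (inner_by_closed centerL_pred_closed).

Lemma alpha_inner (c : Lalg) : alpha (inner (val c)) = inner c.
Proof.
apply/val_inj/funext => a.
rewrite -[RHS]/(a * c - c * a) -[LHS]/(projL (val a * val c - val c * val a)).
have -> : val a * val c - val c * val a = val (a * c - c * a).
  by rewrite -!L_valM; symmetry; exact: raddfB.
exact: projLK.
Qed.

Lemma InDer_sub_Omega : {subset InDer Lalg <= Omega}.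
Proof.
move=> _ /asboolP[c _ ->]; apply/asboolP; exists (inner (val c)).
exact: alpha_inner.
Qed.

Lemma Psi0_sub_Psi : {subset Psi0 <= Psi}.
Proof.
move=> _ /asboolP[_ /asboolP[c cC ->] ->]; apply/asboolP; split=> [|a].
  rewrite alpha_inner; apply/val_inj/funext => a.
  by rewrite -[LHS]/(a * c - c * a) cC subrr.
have E : inner (val c) (val a) = 0.
  rewrite -[LHS]/(val a * val c - val c * val a).
  by rewrite -!L_valM cC subrr.
rewrite /delta E; apply/val_inj/incidence_ext => x y _.
by rewrite /= /restrict if_same.
Qed.

(* No condition is needed on pairs (x, y) from different components: there   *)
(* every element of the incidence algebra vanishes.                          *)
Definition DK : {pred Der incidence} := fun D =>
  `[< exists eps : component X -> Der R,
      forall (g : incidence) i x y, x \in val i -> y \in val i ->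
        D g x y = eps i (g x y) >].

Definition DL : {pred Der Lalg} := fun D =>
  `[< exists eps : component X -> Der R,
      forall (a : Lalg) i x y, x \in val i -> y \in val i ->
        D a x y = eps i (a x y) >].

End IncidenceAlgebra.

Arguments Omega {d} X {T} R.
Arguments Lambda {d} X {T} R.
Arguments Psi {d} X {T} R.
Arguments Psi0 {d} X {T} R.
Arguments In0 {d} X {T} R.
Arguments In1 {d} X {T} R.
Arguments DK {d} X {T} R.
Arguments DL {d} X {T} R.

(* Main.v *)
(* A derivation D of K is determined entrywise: modulo an inner derivation it *)
(* kills every diagonal idempotent e_x, and then (D f)(x, y) depends only on  *)
(* f(x, y), through maps phi_xy : R -> R with                                 *)
(*   phi_xy (r s) = phi_xz (r) s + r phi_zy (s)   for x <= z <= y.            *)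
(* Hence each phi_xx is a derivation of R, and for x <= y phi_xx and phi_yy   *)
(* differ by the inner derivation of phi_xy (1), so that on a connected       *)
(* component all phi_xx agree modulo inner derivations. Correcting by a       *)
(* diagonal element leaves a derivation which acts on L by one derivation of  *)
(* R per component; subtracting the latter leaves an element of Psi. Thus     *)
(* Der K = In + Psi + D_K, and everything else follows because an inner       *)
(* derivation lies in Lambda only if it is defined by an element of L.        *)
Require Import Defs.
From HB Require Import structures.
From mathcomp Require Import all_boot all_order all_algebra.
From mathcomp Require Import finmap.
From mathcomp Require Import all_classical.

Set Implicit Arguments.
Unset Strict Implicit.
Unset Printing Implicit Defensive.

Import Order.TTheory GRing.Theory.
Local Open Scope classical_set_scope.
Local Open Scope ring_scope.
Local Open Scope quotient_scope.

(** * Modules and derivations *)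

(** The heart of the matter is [der_decomp]: each derivation of K is [inner c + psi + ring_der eps],
    with [psi] in [Psi] and one derivation [eps i] of R per component. The element c comes in two
    stages: [inner_kills_idem] makes all diagonal idempotents constants, and [entry_map_class] finds
    a diagonal element b for which the entry maps at equivalent points become [eps] plus the
    commutator with b. What remains after subtracting both vanishes on L, so it lies in [Psi].

    The sum formulas follow by sorting the three summands. [alpha] kills [Psi] and sends inner
    derivations to inner ones ([alpha_InDer]), which gives [Omega]; [inner_Lambda] forces c into L
    when the derivation lies in [Lambda]; splitting c along L and M separates [In1] from the rest.

    Both isomorphisms compare two linear surjections with a common kernel ([lmod_iso_same_kernel]).
    For Omega / InDer L the source is the module of families [eps], for Out K it is the product of
    [Psi] with these families. The kernels are found by [alpha_ring_der_inner], [ring_der_inner] and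
    [Psi_ring_der_inner]. *)

Section Modules.
Variable T : pzRingType.

(** Both targets are U modulo the common kernel. The isomorphism is q after any set-theoretic
    section of p; linearity holds because q identifies exactly the points that p identifies. *)
Lemma lmod_iso_same_kernel (U V W : lmodType T) (p : U -> V) (q : U -> W) :
  linear p -> linear q ->
  (forall v, exists u, p u = v) -> (forall w, exists u, q u = w) ->
  (forall u, p u = 0 <-> q u = 0) -> lmod_iso V W.
Proof.
move=> pL qL /choice[s ps] /choice[s' qs'] ker.
have transfer u u' : p u = p u' <-> q u = q u'.
  have pB : p (- 1 *: u' + u) = p u - p u' by rewrite pL scaleN1r addrC.
  have qB : q (- 1 *: u' + u) = q u - q u' by rewrite qL scaleN1r addrC.
  have := ker (- 1 *: u' + u); rewrite pB qB => -[k1 k2].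
  by split=> e; apply/subr0_eq; [apply: k1|apply: k2]; rewrite e subrr.
have fL : linear (q \o s).
  by move=> t v w /=; rewrite -qL; apply/transfer; rewrite pL !ps.
pose F := GRing.isLinear.Build _ _ _ _ _ fL.
pose f : {linear V -> W} := HB.pack (q \o s) F.
exists f; exists (p \o s') => [v|w] /=.
  by rewrite -[RHS]ps; apply/transfer; rewrite qs'.
by rewrite -[RHS]qs'; apply/transfer; rewrite ps.
Qed.

Lemma lquot_pi_linear (V : lmodType T) (W : submodClosed V) :
  linear (fun v : V => \pi_(lquot W) v).
Proof. by move=> t u v; rewrite lquot_pi_add -lquot_pi_scale. Qed.

Lemma lquot_pi_eq0 (V : lmodType T) (W : submodClosed V) (v : V) :
  \pi_(lquot W) v = 0 <-> v \in W.
Proof.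
have <- : \pi_(lquot W) 0 = 0.
  by have := lquot_pi_linear W (- 1) 0 0; rewrite !scaleN1r !addNr.
by rewrite lquot_eq subr0.
Qed.

Lemma lquot_pi_surj (V : lmodType T) (W : submodClosed V) (u : lquot W) :
  exists v, \pi_(lquot W) v = u.
Proof. by exists (repr u); rewrite reprK. Qed.

Lemma subquot_pi_linear (V : lmodType T) (A B : submodClosed V) :
  linear (fun a : subm A => \pi_(subquot A B) a).
Proof. exact: lquot_pi_linear. Qed.

Lemma subquot_pi_eq (V : lmodType T) (A B : submodClosed V) (a b : subm A) :
  \pi_(subquot A B) a = \pi_(subquot A B) b <-> val a - val b \in B.
Proof. by rewrite -raddfB; exact: (@lquot_eq _ _ (in_subm B)). Qed.

Lemma subquot_pi_eq0 (V : lmodType T) (A B : submodClosed V) (a : subm A) :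
  \pi_(subquot A B) a = 0 <-> val a \in B.
Proof. exact: (@lquot_pi_eq0 _ (in_subm B)). Qed.

Lemma subquot_pi_surj (V : lmodType T) (A B : submodClosed V)
  (u : subquot A B) : exists a, \pi_(subquot A B) a = u.
Proof. exact: lquot_pi_surj. Qed.

Lemma mem_add_pred (V : lmodType T) (A B : {pred V}) v :
  v \in A :+: B <-> exists a b, [/\ a \in A, b \in B & v = a + b].
Proof. by split=> [/asboolP|] //; move=> ?; apply/asboolP. Qed.

End Modules.

Section Derivations.
Variables (T : comNzRingType) (A : algType T).

Lemma der_linear (D : Der A) : linear D.
Proof. by case: D => D /= /asboolP[]. Qed.

HB.instance Definition _ (D : Der A) :=
  GRing.isLinear.Build T A A *:%R D (der_linear D).

Lemma derD (D E : Der A) a : (D + E) a = D a + E a.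
Proof. by []. Qed.

Lemma derN (D : Der A) a : (- D) a = - D a.
Proof. by []. Qed.

Lemma derM (D : Der A) a b : D (a * b) = D a * b + a * D b.
Proof. by case: D => D /= /asboolP[]. Qed.

Lemma der_ext (D E : Der A) : D =1 E -> D = E.
Proof. by move=> DE; apply/val_inj/funext. Qed.

Lemma mem_InDer (D : Der A) :
  D \in InDer A <-> exists c, forall a, D a = a * c - c * a.
Proof.
split=> [/asboolP[c _ ->]|[c Dc]]; first by exists c.
by apply/asboolP; exists c => //; apply: der_ext.
Qed.

End Derivations.

(** * Connected components and equivalence classes *)

Section Components.
Variables (d : Order.disp_t) (X : locFinPreorderType d).
Implicit Types x y z : X.

Lemma connected_refl x : connected_by x x.
Proof. by exists [::]. Qed.

Lemma connected_trans x y z :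
  connected_by x y -> connected_by y z -> connected_by x z.
Proof.
move=> [p [xp <-]] [q [yq <-]]; exists (p ++ q).
by rewrite cat_path xp last_cat.
Qed.

Lemma connected_ind x (P : X -> Prop) :
  P x -> (forall y z, (y >=< z)%O -> P y -> P z) ->
  forall y, connected_by x y -> P y.
Proof.
move=> Px step y [p [xp <-]]; elim: p x Px xp => [|a p IH] x Px //= /andP[xa].
by apply: IH; apply: step xa Px.
Qed.

Lemma connected_comparable x y : (x >=< y)%O -> connected_by x y.
Proof. by move=> xy; exists [:: y]; rewrite /= xy. Qed.

Lemma connected_sym x y : connected_by x y -> connected_by y x.
Proof.
move: y; apply: connected_ind => [|y z yz yx]; first exact: connected_refl.
apply: connected_trans yx; apply: connected_comparable.
by rewrite comparable_sym.
Qed.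

Fact comp_subproof x : [set y | connected_by x y] \in component X.
Proof. by rewrite inE; exists x. Qed.

Definition comp x : component X := SigSub (comp_subproof x).

Lemma mem_comp x : x \in val (comp x).
Proof. by rewrite inE; exact: connected_refl. Qed.

Lemma comp_connected x y : connected_by x y -> comp x = comp y.
Proof.
move=> xy; apply: val_inj; apply/seteqP; split=> z /=.
  by apply: connected_trans; apply: connected_sym.
exact: connected_trans.
Qed.

Lemma connected_comp x y : comp x = comp y -> connected_by x y.
Proof. by move=> xy; have := mem_comp y; rewrite -xy inE. Qed.

Lemma comp_le x y : (x <= y)%O -> comp x = comp y.
Proof.
move=> xy; apply/comp_connected/connected_comparable.
by rewrite /Order.comparable xy.
Qed.

Lemma comp_mem (i : component X) x : x \in val i -> comp x = i.
Proof.
move=> xi; have /set_mem[y iE] := valP i.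
apply: val_inj; rewrite /= iE; move: xi; rewrite iE inE /= => yx.
by apply: (congr1 val (comp_connected (connected_sym yx))).
Qed.

Lemma mem_comp_le x y : (x <= y)%O -> y \in val (comp x).
Proof. by move=> /comp_le ->; exact: mem_comp. Qed.

Lemma comp_surj (i : component X) : exists x, comp x = i.
Proof.
have /set_mem[x iE] := valP i; exists x; apply: comp_mem.
by rewrite iE inE; exact: connected_refl.
Qed.

(** [choose] depends only on the predicate once its default satisfies it, so equivalent points get
    the same representative. *)
Definition class_rep x : X := choose (ord_equiv x) x.

Lemma ord_equiv_refl x : ord_equiv x x.
Proof. by rewrite /ord_equiv lexx. Qed.

Lemma class_rep_equiv x : ord_equiv x (class_rep x).
Proof. by apply: chooseP; exact: ord_equiv_refl. Qed.

Lemma class_rep_eq x y : ord_equiv x y -> class_rep x = class_rep y.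
Proof.
move=> /andP[xy yx].
have xyE : ord_equiv x =1 ord_equiv y.
  move=> z; apply/andP/andP => -[h1 h2]; split.
  - exact: le_trans h1.
  - exact: le_trans xy.
  - exact: le_trans h1.
  - exact: le_trans yx.
rewrite /class_rep (eq_choose xyE); apply: choose_id.
  by rewrite /ord_equiv yx xy.
exact: ord_equiv_refl.
Qed.

End Components.

(** * Derivations of incidence algebras *)

Section Incidence.
Variables (d : Order.disp_t) (X : locFinPreorderType d).
Variables (T : comNzRingType) (R : algType T).
Local Notation K := (incidence X R).
Local Notation L := (Lalg X R).
Implicit Types (f g c : K) (x y z u v : X) (r s : R).

Lemma incD f g x y : (f + g) x y = f x y + g x y.
Proof. by []. Qed.

Lemma incN f x y : (- f) x y = - f x y.
Proof. by []. Qed.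

Lemma incZ (t : T) f x y : (t *: f) x y = t *: f x y.
Proof. by []. Qed.

Lemma inc0 x y : (0 : K) x y = 0.
Proof. by []. Qed.

Lemma incM f g x y :
  (f * g) x y = \sum_(z <- fset_set (Defs.interval x y)) (f x z * g z y).
Proof. exact: incidence_mulE. Qed.

(** * Matrix units and diagonal elements *)

Definition inc_fun (F : X -> X -> R) : X -> X -> R :=
  fun x y => if (x <= y)%O then F x y else 0.

Fact inc_of_subproof F : inc_fun F \in @incidence_pred d X T R.
Proof. by apply/asboolP => x y; rewrite /inc_fun => /negPf ->. Qed.

Definition inc_of F : K := Incidence (inc_of_subproof F).

Lemma inc_ofE F x y : (x <= y)%O -> inc_of F x y = F x y.
Proof. by rewrite /= /inc_fun => ->. Qed.

Definition single u v r : K :=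
  inc_of (fun x y => if (x == u) && (y == v) then r else 0).

Lemma singleE u v r x y : (u <= v)%O ->
  single u v r x y = if (x == u) && (y == v) then r else 0.
Proof.
by move=> uv; rewrite /= /inc_fun; case: andP => [[/eqP-> /eqP->]|_];
   rewrite ?uv ?if_same.
Qed.

Lemma mul_single_r f u v r x y : (u <= v)%O ->
  (f * single u v r) x y = if y == v then f x u * r else 0.
Proof.
move=> uv; rewrite incM; case: eqP => [->|/eqP/negPf yv]; last first.
  by rewrite big1 // => z _; rewrite /= /inc_fun yv andbF if_same mulr0.
have [xu|nxu] := boolP (x <= u)%O; last first.
  rewrite incidence0 // mul0r big_seq big1 // => z.
  rewrite mem_interval => /andP[xz zv]; rewrite inc_ofE // eqxx andbT.
  by case: eqP => [zu|_]; [rewrite -zu xz in nxu|rewrite mulr0].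
rewrite (bigD1_seq u) ?fset_uniq ?mem_interval ?xu //= {1}/inc_fun uv !eqxx /=.
rewrite big1 ?addr0 // => z /negPf zu.
by rewrite /inc_fun zu if_same mulr0.
Qed.

Lemma mul_single_l f u v r x y : (u <= v)%O ->
  (single u v r * f) x y = if x == u then r * f v y else 0.
Proof.
move=> uv; rewrite incM; case: eqP => [->|/eqP/negPf xu]; last first.
  by rewrite big1 // => z _; rewrite /= /inc_fun xu if_same mul0r.
have [vy|nvy] := boolP (v <= y)%O; last first.
  rewrite incidence0 // mulr0 big_seq big1 // => z.
  rewrite mem_interval => /andP[uz zy]; rewrite inc_ofE // eqxx.
  by case: eqP => [zv|_]; [rewrite -zv zy in nvy|rewrite mul0r].
rewrite (bigD1_seq v) ?fset_uniq ?mem_interval ?uv //= {1}/inc_fun uv !eqxx /=.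
rewrite big1 ?addr0 // => z /negPf zv.
by rewrite /inc_fun zv andbF if_same mul0r.
Qed.

Definition diag (b : X -> R) : K :=
  inc_of (fun x y => if x == y then b x else 0).

Lemma mul_diag_l f b x y : (diag b * f) x y = b x * f x y.
Proof.
have [xy|nxy] := boolP (x <= y)%O; last by rewrite !incidence0 ?mulr0.
rewrite incM (bigD1_seq x) ?fset_uniq ?mem_interval ?lexx ?xy //=.
rewrite {1}/inc_fun lexx eqxx big1 ?addr0 // => z.
by rewrite eq_sym /inc_fun => /negPf ->; rewrite if_same mul0r.
Qed.

Lemma mul_diag_r f b x y : (f * diag b) x y = f x y * b y.
Proof.
have [xy|nxy] := boolP (x <= y)%O; last by rewrite !incidence0 ?mul0r.
rewrite incM (bigD1_seq y) ?fset_uniq ?mem_interval ?lexx ?xy //=.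
rewrite {1}/inc_fun lexx eqxx big1 ?addr0 // => z.
by rewrite /inc_fun => /negPf ->; rewrite if_same mulr0.
Qed.

Lemma inner_diagE b f x y : inner (diag b) f x y = f x y * b y - b x * f x y.
Proof.
rewrite -[LHS]/((f * diag b - diag b * f) x y).
by rewrite incD incN mul_diag_l mul_diag_r.
Qed.

Lemma diag_L b : diag b \in @L_pred d X T R.
Proof.
apply/asboolP => x y xy /=; rewrite /inc_fun; case: ifP => // _.
by case: eqP xy => // <-; rewrite ord_equiv_refl.
Qed.

Lemma diag_val b : exists a : L, diag b = val a.
Proof. by exists (MkL (diag_L b)). Qed.

Lemma single_val u r : exists a : L, single u u r = val a.
Proof.
have <- : diag (fun z => if z == u then r else 0) = single u u r.
  apply: incidence_ext => x y xy; rewrite !inc_ofE //.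
  case: (eqVneq x y) => [<-|nxy]; first by rewrite andbb.
  by case: (eqVneq x u) nxy => [->|//]; rewrite eq_sym => /negPf ->.
exact: diag_val.
Qed.

(** * Membership criteria and ring derivations *)

Lemma der_alpha_delta (D : Der K) (a : L) :
  D (val a) = val (alpha D a) + val (delta D a).
Proof. exact: projLM. Qed.

Lemma LambdaP (D : Der K) :
  D \in Lambda X R <-> forall a : L, D (val a) \in @L_pred d X T R.
Proof.
split=> [/asboolP D0 a|DL].
  rewrite der_alpha_delta D0 addr0; exact: valP.
apply/asboolP => a; apply/val_inj/incidence_ext => x y _.
rewrite -[LHS]/(if ~~ ord_equiv x y then D (val a) x y else 0).
case: ifP => // xy; by have /asboolP DaL := DL a; exact: DaL.
Qed.

Lemma PsiP (D : Der K) :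
  D \in Psi X R <-> forall a : L, D (val a) = 0.
Proof.
split=> [/asboolP[a0 d0] a|D0].
  by rewrite der_alpha_delta a0 d0 addr0.
apply/asboolP; split=> [|a].
  apply: der_ext => a; apply/val_inj/incidence_ext => x y _.
  by rewrite -[LHS]/(if ord_equiv x y then D (val a) x y else 0) D0 if_same.
apply/val_inj/incidence_ext => x y _.
by rewrite -[LHS]/(if ~~ ord_equiv x y then D (val a) x y else 0) D0 if_same.
Qed.

(** All z between x and y lie in the component of x, so the same [eps] acts on both factors of each
    term of the product. *)
Fact ring_der_subproof (eps : component X -> Der R) :
  (fun f => inc_of (fun x y => eps (comp x) (f x y))) \in @der_pred T K.
Proof.
apply/asboolP; split=> [t f g|f g]; apply: incidence_ext => x y xy.
  by rewrite incD incZ !inc_ofE // incD incZ der_linear.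
rewrite incD !incM inc_ofE // incM linear_sum -big_split /=.
rewrite big_seq [RHS]big_seq; apply: eq_bigr => z.
rewrite mem_interval => /andP[xz zy].
by rewrite derM /inc_fun xz zy (comp_le xz).
Qed.

Definition ring_der eps : Der K := MkDer (ring_der_subproof eps).

Lemma ring_derE eps f x y : ring_der eps f x y = eps (comp x) (f x y).
Proof.
have [xy|nxy] := boolP (x <= y)%O; first exact: inc_ofE.
by rewrite !incidence0 // linear0.
Qed.

Lemma ring_der_linear : linear ring_der.
Proof.
move=> t e e'; apply: der_ext => f; apply: incidence_ext => x y _.
rewrite -[RHS]/((t *: ring_der e f + ring_der e' f) x y).
by rewrite incD incZ !ring_derE.
Qed.

Lemma DKP (D : Der K) : D \in DK X R <-> exists eps, D = ring_der eps.
Proof.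
split=> [/asboolP[eps De]|[eps ->]]; last first.
  by apply/asboolP; exists eps => f i x y /comp_mem <- _; exact: ring_derE.
exists eps; apply: der_ext => f; apply: incidence_ext => x y xy.
by rewrite ring_derE (De f (comp x)) ?mem_comp ?mem_comp_le.
Qed.

Lemma alpha_ring_derE eps (a : L) x y :
  alpha (ring_der eps) a x y = eps (comp x) (a x y).
Proof.
rewrite -[LHS]/(if ord_equiv x y then ring_der eps (val a) x y else 0).
rewrite ring_derE; case: ifPn => // xy.
by have /asboolP -> // := valP a; rewrite linear0.
Qed.

Lemma DLP (D : Der L) :
  D \in DL X R <-> exists eps, D = alpha (ring_der eps).
Proof.
split=> [/asboolP[eps De]|[eps ->]]; last first.
  by apply/asboolP; exists eps => f i x y /comp_mem <- _;
     exact: alpha_ring_derE.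
exists eps; apply: der_ext => f; apply/val_inj/incidence_ext => x y xy.
by rewrite alpha_ring_derE (De f (comp x)) ?mem_comp ?mem_comp_le.
Qed.

Lemma ring_der_Lambda eps : ring_der eps \in Lambda X R.
Proof.
apply/LambdaP => a; apply/asboolP => x y xy; rewrite ring_derE.
by have /asboolP -> // := valP a; rewrite linear0.
Qed.

Lemma ring_der_inner eps : (forall i, eps i \in InDer R) ->
  exists b, ring_der eps = inner (diag b).
Proof.
move=> eI; have /choice[b be] i := proj1 (mem_InDer (eps i)) (eI i).
exists (fun x => b (comp x)).
apply: der_ext => f; apply: incidence_ext => x y xy.
by rewrite ring_derE inner_diagE be /= (comp_le xy).
Qed.

(** The entry at (x, x) of the commutator of c with r in position (x, x) is the commutator of
    [c x x] with r, so [eps (comp x)] is defined by [c x x]. *)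
Lemma alpha_ring_der_inner eps :
  alpha (ring_der eps) \in InDer L -> forall i, eps i \in InDer R.
Proof.
move=> /mem_InDer[c ec] i; have [x <-] := comp_surj i.
apply/mem_InDer; exists (c x x) => r.
have [a aE] := single_val x r.
have axx : a x x = r by rewrite -[RHS](_ : val a x x = r) // -aE inc_ofE ?eqxx.
have := congr1 (fun a : L => a x x) (ec a); rewrite alpha_ring_derE axx => ->.
rewrite -[LHS]/((val a * val c) x x - (val c * val a) x x).
by rewrite -aE mul_single_l // mul_single_r // eqxx.
Qed.

(** Changing b by a in a commutator trades [r * a] for [a * r], which is how the row and column
    expansions of an entry map differ. *)
Lemma commutator_shift t r a b :
  t + (r * (b - a) - (b - a) * r) + r * a = a * r + (t + (r * b - b * r)).
Proof.
rewrite mulrBr mulrBl opprB [LHS](AC (1*(2*2)*1) ((4*(1*(2*5)))*(3*6))).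
by rewrite /= addNr addr0.
Qed.

(** * Derivations that kill the diagonal idempotents *)

Section Decomposition.
Variable D : Der K.

Definition entry_map x y r : R := D (single x y r) x y.

Hypothesis D_idem : forall x, D (single x x 1) = 0.

(** The idempotents are constants for D, so D commutes with cutting f down to its (x, y) entry by e
    x on the left and e y on the right. *)
Lemma der_entry f x y : (x <= y)%O -> D f x y = entry_map x y (f x y).
Proof.
move=> xy; pose e z := single z z 1 : K.
have fE : single x y (f x y) = e x * f * e y.
  apply: incidence_ext => u v uv.
  rewrite mul_single_r // mul_single_l // inc_ofE //.
  by case: eqP; case: eqP; rewrite //= ?mul0r // mul1r mulr1.
rewrite /entry_map fE !derM !D_idem mul0r add0r mulr0 addr0.
by rewrite mul_single_r // mul_single_l // !eqxx mul1r mulr1.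
Qed.

Lemma entry_map_linear x y : linear (entry_map x y).
Proof.
move=> t r s.
have sE : single x y (t *: r + s) = t *: single x y r + single x y s.
  apply: incidence_ext => u v uv.
  rewrite incD incZ !inc_ofE //.
  by case: ifP => // _; rewrite scaler0 addr0.
by rewrite /entry_map sE der_linear.
Qed.

Lemma entry_mapM x z y r s : (x <= z)%O -> (z <= y)%O ->
  entry_map x y (r * s) = entry_map x z r * s + r * entry_map z y s.
Proof.
move=> xz zy; have xy := le_trans xz zy.
have sE : single x y (r * s) = single x z r * single z y s.
  apply: incidence_ext => u v _; rewrite mul_single_r // !singleE //.
  by rewrite eqxx andbT andbC; case: eqP; case: eqP; rewrite ?mul0r.
by rewrite /entry_map sE derM incD mul_single_r // mul_single_l // !eqxx.
Qed.

Fact diag_entry_der_subproof x : entry_map x x \in @der_pred T R.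
Proof.
by apply/asboolP; split=> [|r s]; [exact: entry_map_linear|exact: entry_mapM].
Qed.

Definition diag_entry_der x : Der R := MkDer (diag_entry_der_subproof x).

Lemma entry_map_row x y r : (x <= y)%O ->
  entry_map x y r = entry_map x x r + r * entry_map x y 1.
Proof. by move=> xy; rewrite -{1}[r]mulr1 (@entry_mapM x x y) // mulr1. Qed.

Lemma entry_map_col x y r : (x <= y)%O ->
  entry_map x y r = entry_map x y 1 * r + entry_map y y r.
Proof.
by move=> xy; rewrite -{1}[r]mul1r (@entry_mapM x y y) // mul1r.
Qed.

Lemma entry_map_cocycle x y z : (x <= y)%O -> (y <= z)%O ->
  entry_map x z 1 = entry_map x y 1 + entry_map y z 1.
Proof.
by move=> xy yz; rewrite -{1}[1]mulr1 (@entry_mapM x y z) // mulr1 mul1r.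
Qed.

(** For y <= z put c = [entry_map y z 1]. Expanding [entry_map y z r] by row and by column shows
    that the diagonal maps at y and z differ by the commutator r c - c r; these corrections add up,
    with signs, along a path. *)
Lemma entry_map_diag_connected x y : connected_by x y ->
  exists b, forall r, entry_map y y r = entry_map x x r + (r * b - b * r).
Proof.
move: y; apply: connected_ind => [|y z yz [b yE]].
  by exists 0 => r; rewrite mulr0 mul0r subrr addr0.
have [yz'|zy] := orP yz.
  exists (b + entry_map y z 1) => r.
  apply: (addrI (entry_map y z 1 * r)); rewrite -entry_map_col //.
  by rewrite entry_map_row // -commutator_shift addrK yE.
exists (b - entry_map z y 1) => r.
apply: (addIr (r * entry_map z y 1)); rewrite -entry_map_row //.
by rewrite entry_map_col // commutator_shift yE.
Qed.

Lemma entry_map_diag : exists (eps : component X -> Der R) (b : X -> R),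
  forall x r, entry_map x x r = eps (comp x) r + (r * b x - b x * r).
Proof.
have /choice[base baseE] := @comp_surj d X.
exists (fun i => diag_entry_der (base i)).
suff /choice[b bE] : forall x, exists b, forall r,
    entry_map x x r = diag_entry_der (base (comp x)) r + (r * b - b * r).
  by exists b.
by move=> x; apply/entry_map_diag_connected/connected_comp; rewrite baseE.
Qed.

(* The coboundary b of entry_map_diag is only unique up to central terms; it  *)
(* is kept at class representatives and transported along each class by the   *)
(* cocycle entry_map x y 1, so that the identity also holds off the diagonal. *)
Lemma entry_map_class : exists (eps : component X -> Der R) (b : X -> R),
  forall x y r, ord_equiv x y ->
    entry_map x y r = eps (comp x) r + (r * b y - b x * r).
Proof.
have [eps [b0 b0E]] := entry_map_diag.
exists eps, (fun x => b0 (class_rep x) - entry_map x (class_rep x) 1).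
move=> x y r xy; have /andP[xley ylex] := xy.
rewrite -(class_rep_eq xy); move: (class_rep x) (class_rep_equiv x) => z.
move=> /andP[xz zx].
have -> : b0 z - entry_map y z 1 = b0 z - entry_map x z 1 + entry_map x y 1.
  rewrite (entry_map_cocycle xley (le_trans ylex xz)) opprD addrA addrAC.
  by rewrite subrK.
rewrite mulrDr [X in _ + X]addrAC addrA entry_map_row //.
(* Only the diagonal case at x is left; the two expansions of [entry_map x z r] reduce it to the
   representative z. *)
congr (_ + _); apply: (addIr (r * entry_map x z 1)).
by rewrite -entry_map_row // entry_map_col // b0E (comp_le xz) commutator_shift.
Qed.

(** On L the remainder vanishes entrywise: by [entry_map_class] at equivalent points, and elsewhere
    because the entry of a is 0. *)
Lemma der_decomp_idem : exists b psi eps, psi \in Psi X R /\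
  D = inner (diag b) + psi + ring_der eps.
Proof.
have [eps [b bE]] := entry_map_class.
exists b, (D - inner (diag b) - ring_der eps), eps; split; last first.
  by rewrite addrA subrK addrC subrK.
apply/PsiP => a; apply: incidence_ext => x y xy.
have incBB f g h : (f - g - h) x y = f x y - g x y - h x y by [].
rewrite 2!derD 2!derN incBB der_entry // inner_diagE ring_derE inc0.
have [xy'|nxy] := boolP (ord_equiv x y).
  by rewrite bE // addrK subrr.
have /asboolP aL := valP a.
have -> : val a x y = 0 by exact: aL.
have entry_map0 : entry_map x y 0 = 0.
  by have := entry_map_linear x y (- 1) 0 0; rewrite !scaleN1r !addNr.
by rewrite entry_map0 mul0r mulr0 !subr0 linear0 subr0.
Qed.

End Decomposition.

(** * Decomposition of an arbitrary derivation *)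

Lemma single_idemM x y :
  single x x 1 * single y y 1 = (if x == y then single x x 1 else 0) :> K.
Proof.
apply: incidence_ext => u v _; rewrite mul_single_r // !singleE //.
rewrite mulr1; case: (eqVneq x y) => [<-|xy]; last by rewrite andbF !if_same.
by rewrite singleE // andbT andbC; case: eqP.
Qed.

Lemma inner_kills_idem (D : Der K) : exists c, forall x,
  (D + inner c) (single x x 1) = 0.
Proof.
pose e z := single z z 1 : K.
(* Column y of c is column y of D (e y), so the commutator cancels the off-diagonal part of column x
   of D (e x). Row x cancels because D (e x * e v) = 0 for v <> x; the other entries of D (e x), and
   the one at (x, x), vanish since e x is idempotent. *)
exists (inc_of (fun x y => D (e y) x y)) => x.
set c := inc_of _; apply: incidence_ext => u v uv.
rewrite -[LHS]/((D (e x) + (e x * c - c * e x)) u v).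
rewrite !(incD, incN) mul_single_l // mul_single_r // mul1r mulr1 inc0.
have De z w : D (e z * e w) u v =
    (if v == w then D (e z) u w else 0) + (if u == z then D (e w) z v else 0).
  rewrite /e derM incD mul_single_r // mul_single_l //.
  by rewrite mul1r mulr1.
have Dex := De x x; rewrite [e x * e x]single_idemM eqxx -/(e x) in Dex.
case: (eqVneq u x) (eqVneq v x) => [ux|ux] [vx|vx].
- subst u v; rewrite subrr addr0; move/esym: Dex; rewrite !eqxx.
  by rewrite -[RHS]addr0 => /addrI.
- subst u; rewrite subr0 inc_ofE //; have := De x v.
  by rewrite [e x * e v]single_idemM eq_sym (negPf vx) linear0 inc0 !eqxx.
- by subst v; rewrite add0r inc_ofE // subrr.
by rewrite Dex (negPf ux) (negPf vx) subrr !addr0.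
Qed.

Lemma innerD c c' : inner (c + c') = inner c + inner c'.
Proof. by rewrite -[c]scale1r inner_linear !scale1r. Qed.

Lemma der_decomp (D : Der K) : exists c psi eps, psi \in Psi X R /\
  D = inner c + psi + ring_der eps.
Proof.
have [c Dc] := inner_kills_idem D.
have [b [psi [eps [psiP DcE]]]] := der_decomp_idem Dc.
exists (diag b - c), psi, eps; split=> //.
apply: (addIr (inner c)).
rewrite DcE -[in LHS](subrK c (diag b)) [in LHS]innerD.
by rewrite [RHS]addrAC [in RHS](addrAC _ psi).
Qed.

Lemma projL_L f : val (projL f) \in @L_pred d X T R.
Proof. exact: valP. Qed.

Lemma projM_M f : val (projM f) \in @M_pred d X T R.
Proof. exact: valP. Qed.

(** * Sum formulas for Omega, Lambda and Der K *)

Lemma LambdaD (D E : Der K) :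
  D \in Lambda X R -> E \in Lambda X R -> D + E \in Lambda X R.
Proof.
move=> /LambdaP DL /LambdaP EL; apply/LambdaP => a.
by rewrite derD rpredD.
Qed.

Lemma Psi_Lambda (D : Der K) : D \in Psi X R -> D \in Lambda X R.
Proof. by move=> /PsiP D0; apply/LambdaP => a; rewrite D0 rpred0. Qed.

(** Testing on the diagonal idempotent at x, an element of L, recovers [c x y] for every y not
    equivalent to x. *)
Lemma inner_Lambda c : inner c \in Lambda X R <-> c \in @L_pred d X T R.
Proof.
split=> [/LambdaP cL|cL]; last first.
  by apply/LambdaP => a; rewrite /= rpredB ?rpredM //; exact: valP.
apply/asboolP => x y xy; have [a aE] := single_val x 1.
have /asboolP/(_ x y xy) := cL a.
rewrite -aE -[X in X -> _]/((single x x 1 * c - c * single x x 1) x y = 0).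
rewrite incD incN mul_single_l // mul_single_r // eqxx mul1r.
case: eqP => [yx|_]; last by rewrite subr0.
by rewrite yx ord_equiv_refl in xy.
Qed.

Lemma L_M_eq0 f : f \in @L_pred d X T R -> f \in @M_pred d X T R -> f = 0.
Proof.
move=> /asboolP fL /asboolP fM; apply: incidence_ext => x y _.
by have [/fM|/fL] := boolP (ord_equiv x y).
Qed.

Lemma inner0 : inner (0 : K) = 0.
Proof. by apply: der_ext => f; rewrite /= mulr0 mul0r subrr. Qed.

Lemma alphaD (D E : Der K) : alpha (D + E) = alpha D + alpha E.
Proof. by rewrite -[D]scale1r alpha_linear !scale1r. Qed.

Lemma alpha_InDer c : alpha (inner c) \in InDer L.
Proof.
apply/mem_InDer; exists (projL c) => a.
rewrite -[LHS]/(projL (val a * c - c * val a)).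
rewrite -[_ * c]scale1r addrC -scaleN1r projL_linear scale1r scaleN1r.
by rewrite !projL_mul projLK addrC.
Qed.

Lemma inner_projLM c : inner c = inner (val (projM c)) + inner (val (projL c)).
Proof. by rewrite {1}(projLM c) addrC innerD. Qed.

Lemma OmegaE : Omega X R =i DL X R :+: InDer L.
Proof.
move=> D; apply/idP/idP => [/asboolP[E <-]|].
  have [c [psi [eps [/asboolP[psi0 _] ->]]]] := der_decomp E.
  apply/mem_add_pred; exists (alpha (ring_der eps)), (alpha (inner c)).
  split; [by apply/DLP; exists eps|exact: alpha_InDer|].
  by rewrite !alphaD psi0 addr0 addrC.
move=> /mem_add_pred[_ [E [/DLP[eps ->] EI ->]]].
rewrite rpredD //; last exact: InDer_sub_Omega.
by apply/asboolP; exists (ring_der eps).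
Qed.

Lemma Psi_DK_independent : independent (Psi X R) (DK X R).
Proof.
move=> D /PsiP D0 /DKP[eps De]; apply: der_ext => f.
(* The value [f x y] is moved to position (x, x), inside L, where D vanishes; hence [eps (comp x)]
   kills it. *)
apply: incidence_ext => x y xy; have [a aE] := single_val x (f x y).
have := congr1 (fun g : K => g x x) (D0 a).
by rewrite -aE De !ring_derE inc_ofE ?lexx // eqxx.
Qed.

Lemma mem_Psi_DK (psi : Der K) eps : psi \in Psi X R ->
  psi + ring_der eps \in Psi X R :+: DK X R.
Proof.
move=> psiP; apply/mem_add_pred; exists psi, (ring_der eps); split=> //.
by apply/DKP; exists eps.
Qed.

Lemma Psi_DK_Lambda (D : Der K) : D \in Psi X R :+: DK X R -> D \in Lambda X R.
Proof.
move=> /mem_add_pred[psi [_ [psiP /DKP[eps ->] ->]]].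
by apply: LambdaD; [exact: Psi_Lambda|exact: ring_der_Lambda].
Qed.

Lemma LambdaE : Lambda X R =i In0 X R :+: (Psi X R :+: DK X R).
Proof.
move=> D; apply/idP/idP => [DL|]; last first.
  move=> /mem_add_pred[_ [E [/asboolP[c cL ->] /Psi_DK_Lambda EL ->]]].
  by apply: LambdaD => //; apply/inner_Lambda.
have [c [psi [eps [psiP DE]]]] := der_decomp D.
apply/mem_add_pred; exists (inner c), (psi + ring_der eps).
split; [|exact: mem_Psi_DK|by rewrite addrA].
apply/asboolP; exists c => //; apply/inner_Lambda/LambdaP => a.
have /PsiP psi0 := psiP; have /LambdaP/(_ a) := DL.
rewrite DE 2!derD psi0 addr0 => DaL.
rewrite -[_ (val a)](addrK (ring_der eps (val a))) rpredB //.
by have /LambdaP := ring_der_Lambda eps.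
Qed.

Lemma DerE : predT =i InDer K :+: (Psi X R :+: DK X R).
Proof.
move=> D; apply/esym/mem_add_pred.
have [c [psi [eps [psiP ->]]]] := der_decomp D.
exists (inner c), (psi + ring_der eps); split; last by rewrite addrA.
  by apply/mem_InDer; exists c.
exact: mem_Psi_DK.
Qed.

Lemma Der_In1_LambdaE :
  predT =i In1 X R :+: (In0 X R :+: (Psi X R :+: DK X R)).
Proof.
move=> D; apply/esym/mem_add_pred.
have [c [psi [eps [psiP ->]]]] := der_decomp D.
exists (inner (val (projM c))).
exists (inner (val (projL c)) + (psi + ring_der eps)); split.
- by apply/asboolP; exists (val (projM c)); first exact: projM_M.
- apply/mem_add_pred; exists (inner (val (projL c))), (psi + ring_der eps).
  split=> //; last exact: mem_Psi_DK.
  by apply/asboolP; exists (val (projL c)); first exact: projL_L.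
by rewrite inner_projLM !addrA.
Qed.

Lemma In1_Lambda_independent :
  independent (In1 X R) (In0 X R :+: (Psi X R :+: DK X R)).
Proof.
move=> _ /asboolP[c cM ->]; rewrite -LambdaE => /inner_Lambda cL.
by rewrite (L_M_eq0 cL cM) inner0.
Qed.

(** * Quotients by inner derivations *)

Lemma prod_pi_linear :
  linear (fun (eps : component X -> Der R) i => \pi_(Out R) (eps i)).
Proof. by move=> t e e'; apply/funext => i; exact: lquot_pi_linear. Qed.

Lemma prod_pi_surj (w : component X -> Out R) :
  exists eps : component X -> Der R, (fun i => \pi_(Out R) (eps i)) = w.
Proof.
by exists (fun i => repr (w i)); apply/funext => i; rewrite reprK.
Qed.

Lemma prod_pi_eq0 (eps : component X -> Der R) :
  (fun i => \pi_(Out R) (eps i)) = 0 <-> forall i, eps i \in InDer R.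
Proof.
split=> [e0 i|eI].
  by apply/lquot_pi_eq0; rewrite -[RHS](congr1 (@^~ i) e0).
by apply/funext => i; apply/lquot_pi_eq0.
Qed.

Fact alpha_ring_der_Omega eps : alpha (ring_der eps) \in Omega X R.
Proof. by apply/asboolP; exists (ring_der eps). Qed.

Lemma Omega_quot_iso :
  lmod_iso (subquot (Omega X R) (InDer L)) (component X -> Out R).
Proof.
pose p eps := \pi_(subquot (Omega X R) (InDer L))
  (Subm (alpha_ring_der_Omega eps)).
apply: (lmod_iso_same_kernel (p := p)).
- move=> t e e'; rewrite /p -subquot_pi_linear; congr (\pi_ _ _).
  by apply/val_inj; rewrite /= ring_der_linear alpha_linear.
- exact: prod_pi_linear.
- move=> u; have [D <-] := subquot_pi_surj u.
  have := valP D; rewrite OmegaE => /mem_add_pred[_ [E [/DLP[eps ->] EI DE]]].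
  by exists eps; apply/subquot_pi_eq; rewrite DE /= opprD addNKr rpredN.
- exact: prod_pi_surj.
move=> eps; rewrite prod_pi_eq0 subquot_pi_eq0 /=.
split=> [|/ring_der_inner[b ->]]; first exact: alpha_ring_der_inner.
exact: alpha_InDer.
Qed.

(** This is the kernel of the map from [Psi] times the families [eps] onto Out K. If the sum is
    [inner c], then c is in L; applying [alpha], which kills [psi], makes each [eps i] inner, so
    [ring_der eps] is defined by a diagonal b. *)
Lemma Psi_ring_der_inner (psi : Der K) eps : psi \in Psi X R ->
  psi + ring_der eps \in InDer K <->
  psi \in Psi0 X R /\ forall i, eps i \in InDer R.
Proof.
move=> psiP; split=> [/asboolP[c _ psiE]|[/asboolP[c _ ->]]]; last first.
  move=> /ring_der_inner[b ->]; rewrite -innerD.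
  by apply/asboolP; exists (c + diag b).
have cL : c \in @L_pred d X T R.
  apply/inner_Lambda; rewrite -psiE.
  by apply: LambdaD; [exact: Psi_Lambda|exact: ring_der_Lambda].
have eI : forall i, eps i \in InDer R.
  apply: alpha_ring_der_inner.
  have /asboolP[psi0 _] := psiP; rewrite -[alpha _]add0r -psi0 -alphaD psiE.
  exact: alpha_InDer.
split=> //; have [b epsE] := ring_der_inner eI.
have zL : c - diag b \in @L_pred d X T R by rewrite rpredB ?diag_L.
have psiE' : psi = inner (c - diag b).
  by apply: (addIr (ring_der eps)); rewrite psiE epsE -innerD subrK.
apply/asboolP; exists (c - diag b) => //.
(* [psi] is defined by c - diag b and vanishes on L, so this element is central in L. *)
apply/asboolP; exists (MkL zL) => // a.
apply/val_inj; rewrite !L_valM /=; apply/esym/subr0_eq.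
by have /PsiP/(_ a) := psiP; rewrite psiE'.
Qed.

Lemma Out_incidence_iso :
  lmod_iso (Out K) (subquot (Psi X R) (Psi0 X R) * (component X -> Out R))%type.
Proof.
pose U := (subm (Psi X R) * (component X -> Der R))%type.
pose p (u : U) := \pi_(Out K) (val u.1 + ring_der u.2).
pose q (u : U) := (\pi_(subquot (Psi X R) (Psi0 X R)) u.1,
                   (fun i => \pi_(Out R) (u.2 i)) : component X -> Out R).
apply: (lmod_iso_same_kernel (p := p) (q := q)).
- move=> t u u'; rewrite /p -lquot_pi_linear; congr (\pi_ _ _).
  by rewrite /= ring_der_linear scalerDr addrACA.
- move=> t u u'; congr (_, _); first exact: subquot_pi_linear.
  exact: prod_pi_linear.
- move=> w; have [D <-] := lquot_pi_surj w.
  have [c [psi [eps [psiP ->]]]] := der_decomp D.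
  exists (Subm psiP, eps); apply/lquot_eq.
  rewrite /= -[inner c + _ + _]addrA [inner c + _]addrC opprD addrA subrr add0r.
  by rewrite rpredN; apply/mem_InDer; exists c.
- move=> [w w']; have [psi <-] := subquot_pi_surj w.
  by have [eps <-] := prod_pi_surj w'; exists (psi, eps).
move=> [psi eps]; rewrite /p /q /= lquot_pi_eq0.
have psiP := valP psi; split=> [/(Psi_ring_der_inner _ psiP)[psi0 eps0]|].
  by congr (_, _); [apply/subquot_pi_eq0|apply/prod_pi_eq0].
case=> /subquot_pi_eq0 psi0 /prod_pi_eq0 eps0.
exact/(Psi_ring_der_inner _ psiP).
Qed.

End Incidence.

Theorem theorem17p8 (d : Order.disp_t) (X : locFinPreorderType d)
    (T : comNzRingType) (R : algType T) :
  [/\ Omega X R =i DL X R :+: InDer (Lalg X R) /\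
      lmod_iso (subquot (Omega X R) (InDer (Lalg X R)))
               (component X -> Out R),
      [/\ independent (Psi X R) (DK X R),
          Lambda X R =i In0 X R :+: (Psi X R :+: DK X R),
          predT =i InDer (incidence X R) :+: (Psi X R :+: DK X R),
          predT =i In1 X R :+: (In0 X R :+: (Psi X R :+: DK X R)) &
          independent (In1 X R) (In0 X R :+: (Psi X R :+: DK X R))] &
      lmod_iso (Out (incidence X R))
               (subquot (Psi X R) (Psi0 X R) * (component X -> Out R))%type].
Proof.
split; [|split|exact: Out_incidence_iso].
- by split; [exact: OmegaE|exact: Omega_quot_iso].
- exact: Psi_DK_independent.
- exact: LambdaE.
- exact: DerE.
- exact: Der_In1_LambdaE.
exact: In1_Lambda_independent.
Qed.
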